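(* Consider the multi-environment structural causal model with interventions on $X$ described in the context, with acyclic graph $G$, intervention set $I\subseteq[d]$ and augmented model $\tilde M$. Let $S^\star=\mathtt{pa}(d+1)$, let $m^\star$ be the common conditional expectation $m^{(e,S^\star)}$ ($e\in\mathcal E$), and define $$I^\star=\{j:\ j\in\mathtt{ch}(d+1),\ \mathtt{at}(j)\cap\mathtt{ch}(d+1)=\emptyset\}.$$ Let (Id) denote the condition: for any $S\subseteq[d]$ with $\bar\mu(\{m^\star\ne\bar m^{(S\cup S^\star)}\})>0$, there exist $e,e'\in\mathcal E$ with $(\mu^{(e)}\wedge\mu^{(e')})(\{m^{(e,S)}\ne m^{(e',S)}\})>0$. (Sufficiency) Suppose that (a) for every $S\subseteq[d]$ containing a descendant of $Y$ (i.e. $d+1\in\bigcup_{j\in S}\mathtt{at}(j)$), if $E$ and $Y$ are not conditionally independent given $X_S$ under $\tilde M$, then there exist $e,e'\in\mathcal E$ with $(\mu^{(e)}\wedge\mu^{(e')})(\{m^{(e,S)}\ne m^{(e',S)}\})>0$; (b) $\tilde M$ is faithful: for all disjoint $A,B,C\subseteq[d+2]$, if $Z_A$ and $Z_B$ are conditionally independent given $Z_C$, then $A$ and $B$ are d-separated by $C$ in $\tilde G$. If $I\supseteq I^\star$, then (Id) holds. (Necessity) Moreover, if $\bar m^{(S^\star\cup S)}\ne m^\star$ (i.e. $\bar\mu(\{\bar m^{(S^\star\cup S)}\ne m^\star\})>0$) for every $S\subseteq[d]$ with $\mathtt{ch}(d+1)\cap S\ne\emptyset$, then (Id) holds only if $I\supseteq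 I^\star$.
   Context: Multi-environment SCM. $\mathcal E=\{0,\dots,|\mathcal E|-1\}$. For each $e\in\mathcal E$, $Z^{(e)}=(Z^{(e)}_1,\dots,Z^{(e)}_{d+1})=(X_1^{(e)},\dots,X_d^{(e)},Y^{(e)})$ is generated by $$X_j^{(e)}\leftarrow f_j^{(e)}(Z^{(e)}_{\mathtt{pa}(j)},U_j),\ j=1,\dots,d,\qquad Y^{(e)}\leftarrow f_{d+1}(X^{(e)}_{\mathtt{pa}(d+1)},U_{d+1}).$$ The exogenous variables $U_1,\dots,U_{d+1}$ are independent with joint law $\nu$; $\nu$, the parent sets $\mathtt{pa}(j)\subseteq[d+1]$ and $f_{d+1}$ are the same for all $e$, while $f_j^{(e)}$, $j\le d$, may vary with $e$. The directed graph $G$ on $[d+1]$ with edges $i\to j$ iff $i\in\mathtt{pa}(j)$ is acyclic. $\mathbb E|Y^{(e)}|^2<\infty$. In this model $m^{(e,\mathtt{pa}(d+1))}$ does not depend on $e$. $\mathtt{ch}(k)=\{j:k\in\mathtt{pa}(j)\}$; $\mathtt{at}(k)=\mathtt{pa}(k)\cup\bigcup_{j\in\mathtt{pa}(k)}\mathtt{at}(j)$ is the set of ancestors of $k$ (with respect to $G$). The set of intervened variables is $I=\{j\in[d]:\exists e\in\mathcal E,\ f_j^{(e)}\ne f_j^{(0)}\}$. Augmented model $\tilde M$, on $Z=(Z_1,\dots,Z_{d+2})=(X_1,\dots,X_d,Y,E)$: $E\leftarrow U_{d+2}$ with $U_{d+2}\sim\mathrm{Uniform}(\mathcal E)$ independent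 of $(U_1,\dots,U_{d+1})\sim\nu$; $X_j\leftarrow f_j^{(0)}(Z_{\mathtt{pa}(j)},U_j)$ for $j\in[d]\setminus I$; $X_j\leftarrow f_j^{(E)}(Z_{\mathtt{pa}(j)},U_j)$ for $j\in I$; $Y\leftarrow f_{d+1}(X_{\mathtt{pa}(d+1)},U_{d+1})$. Its graph $\tilde G$ on $[d+2]$ is $G$ together with edges $d+2\to j$ for $j\in I$. Notation. $\mu^{(e)}$ is the law of $(X^{(e)},Y^{(e)})$; $\bar\mu=\frac1{|\mathcal E|}\sum_e\mu^{(e)}$; $\mu^{(e)}_{x,S},\bar\mu_{x,S}$ are the marginals of $X_S$; $m^{(e,S)}(x)=\mathbb E[Y^{(e)}|X^{(e)}_S=x_S]$; $\rho_S^{(e)}=d\mu^{(e)}_{x,S}/d\bar\mu_{x,S}$; $\bar m^{(S)}=\frac1{|\mathcal E|}\sum_e\rho_S^{(e)}m^{(e,S)}$ (the conditional expectation of $Y$ given $X_S$ under $\bar\mu$). $\mu\wedge\nu$ has density the pointwise minimum of the densities of $\mu,\nu$ with respect to a common dominating measure. *)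

(* Defs.v *)
From HB Require Import structures.
From mathcomp Require Import all_boot all_order all_algebra.
From mathcomp Require Import all_classical all_reals all_analysis.

Set Implicit Arguments.
Unset Strict Implicit.
Unset Printing Implicit Defensive.

Import Order.TTheory GRing.Theory Num.Theory.
Import numFieldNormedType.Exports.

Local Open Scope classical_set_scope.
Local Open Scope ring_scope.
Local Open Scope charge_scope.

(* A directed graph on V is given by its parent sets: there is an edge i -> j
   iff i \in pa j. *)

Section graphs.
Variables (V : finType) (pa : V -> {set V}).

Definition ch (k : V) : {set V} := [set j | k \in pa j]%SET.

(* Proper ancestors: i is in at(k) iff some directed path, possibly of length
   zero, leads from i to a parent of k. *)
Definition at_ (k : V) : {set V} :=
  [set i | [exists j in pa k, connect (fun a b => a \in pa b) i j]]%SET.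

Lemma at_rec k : at_ k = pa k :|: \bigcup_(j in pa k) at_ j.
Proof.
apply/setP => i; rewrite !inE; apply/exists_inP/orP => [[j jk /connectP]|].
  case=> p; elim/last_ind: p j jk => [|p b IH] j jk.
    by move=> _ /= <-; left.
  rewrite last_rcons rcons_path => /andP[pp eb] jb; subst b.
  right; apply/bigcupP; exists j => //; rewrite inE; apply/exists_inP.
  by exists (last i p) => //; apply/connectP; exists p.
case=> [ik|/bigcupP[j jk]]; first by exists i.
rewrite inE => /exists_inP[l lj il]; exists j => //.
by rewrite (connect_trans il)// connect1.
Qed.

Definition acyclic : Prop := forall k, k \notin at_ k.

(* p is the sequence of nodes of a path of the skeleton.  An inner node b with
   neighbours a and c on p is a collider if a -> b <- c; it lets the path
   through iff b or one of its descendants is in C.  A non-collider lets the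
   path through iff it is not in C. *)
Fixpoint active (C : {set V}) (p : seq V) : bool :=
  if p is a :: ((b :: c :: _) as q) then
    (if (a \in pa b) && (c \in pa b)
     then [exists s in C, (s == b) || (b \in at_ s)]
     else b \notin C) && active C q
  else true.

Definition d_separated (A B C : {set V}) : Prop :=
  forall (a : V) (p : seq V), a \in A -> last a p \in B ->
    path (fun i j => (i \in pa j) || (j \in pa i)) a p -> uniq (a :: p) ->
    ~~ active C (a :: p).

End graphs.

(* The subvector (z_i), i in S, in increasing order of the indices. *)
Definition coords (R : realType) n (S : {set 'I_n}) (z : n.-tuple R) :
  #|S|.-tuple R := [tuple tnth z (enum_val i) | i < #|S|].

Section coords_measurable.
Context (R : realType) n (S : {set 'I_n}).

Lemma measurable_coords : measurable_fun [set: n.-tuple R] (@coords R n S).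
Proof.
apply/measurable_fun_tnthP => i.
rewrite (_ : _ \o _ = fun z : n.-tuple R => tnth z (enum_val i)).
  exact: measurable_tnth.
by apply/funext => z /=; rewrite tnth_mktuple.
Qed.

HB.instance Definition _ :=
  isMeasurableFun.Build _ _ _ _ (@coords R n S) measurable_coords.

End coords_measurable.

Section probability_notions.
Local Open Scope ereal_scope.
Context d (T : measurableType d) (R : realType).

Definition mixture k (mu : 'I_k.+1 -> probability T R) (A : set T) : \bar R :=
  (k.+1%:R^-1)%:E * \sum_(e < k.+1) mu e A.

Section mixture_probability.
Context k (mu : 'I_k.+1 -> probability T R).

Let k_ge0 : (0 <= k.+1%:R^-1 :> R)%R.
Proof. by rewrite invr_ge0. Qed.

Let mixtureE : mixture mu =
  mscale (NngNum k_ge0)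
         (msum (fun i => mu (inord i)) k.+1).
Proof.
apply/funext => A; rewrite /mixture /mscale /msum /=.
by congr (_ * _); apply: eq_bigr => i _; rewrite inord_val.
Qed.

Let mixture0 : mixture mu set0 = 0.
Proof. by rewrite mixtureE measure0. Qed.

Let mixture_ge0 A : 0 <= mixture mu A.
Proof. by rewrite mixtureE measure_ge0. Qed.

Let mixture_sigma_additive : semi_sigma_additive (mixture mu).
Proof. by rewrite mixtureE; exact: measure_semi_sigma_additive. Qed.

HB.instance Definition _ := isMeasure.Build _ _ _ (mixture mu)
  mixture0 mixture_ge0 mixture_sigma_additive.

Let mixture_setT : mixture mu setT = 1.
Proof.
rewrite /mixture (eq_bigr (fun=> 1%:E)) => [|e _]; last exact: probability_setT.
by rewrite sumEFin sumr_const card_ord -EFinM mulVf// pnatr_eq0.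
Qed.

HB.instance Definition _ :=
  Measure_isProbability.Build _ _ _ (mixture mu) mixture_setT.

End mixture_probability.

(* The measure mu /\ nu, with (mu + nu) / 2 as common dominating measure. *)
Definition meet (mu nu : probability T R) (A : set T) : \bar R :=
  let la := mixture (fun i : 'I_2 => if i == ord0 then mu else nu) in
  \int[la]_(x in A)
    mine (('d (charge_of_finite_measure mu) '/d la) x)
         (('d (charge_of_finite_measure nu) '/d la) x).

(* m is a version of the regression function x |-> E[W | X = x]. *)
Definition is_cond_exp d' (T' : measurableType d') (P : probability T R)
    (X : {mfun T >-> T'}) (W : T -> R) (m : T' -> R) : Prop :=
  [/\ measurable_fun setT m,
      P.-integrable setT (fun w => (m (X w))%:E) &
      forall B, measurable B ->
        \int[P]_(w in X @^-1` B) (m (X w))%:E =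
        \int[P]_(w in X @^-1` B) (W w)%:E].

(* X and Y are conditionally independent given V.  Versions of conditional
   probabilities exist and are almost surely unique, so that quantifying over
   all versions is the same as fixing one. *)
Definition cond_indep d1 d2 d3 (T1 : measurableType d1) (T2 : measurableType d2)
    (T3 : measurableType d3) (P : probability T R) (X : {mfun T >-> T1})
    (Y : {mfun T >-> T2}) (V : {mfun T >-> T3}) : Prop :=
  forall (F : set T1) (G : set T2) (p q : T3 -> R),
    measurable F -> measurable G ->
    is_cond_exp P V (\1_(X @^-1` F)) p ->
    is_cond_exp P V (\1_(Y @^-1` G)) q ->
    is_cond_exp P V (\1_(X @^-1` F `&` Y @^-1` G)) (fun v => p v * q v)%R.

End probability_notions.

(* The nodes 1, ..., d+1 are the elements of 'I_d.+1 and the nodes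
   1, ..., d+2 those of 'I_d.+2; [node_up] is the inclusion of the former into
   the latter. *)
Definition node_Y d : 'I_d.+1 := ord_max.
Definition node_E d : 'I_d.+2 := ord_max.
Definition node_up d (j : 'I_d.+1) : 'I_d.+2 := lift ord_max j.

(* The environments are the elements of 'I_k.+1, i.e. there are k + 1 of them;
   mech e j is the structural function f_j^(e), defined on the values of the
   parents of j and the value of the exogenous variable U_j, and T j is
   the space in which U_j takes its values. *)
Record scm (R : realType) (d k : nat) (dU : 'I_d.+1 -> measure_display)
    (T : forall j, measurableType (dU j)) := Scm {
  parents : 'I_d.+1 -> {set 'I_d.+1} ;
  mech : 'I_k.+1 -> forall j, #|parents j|.-tuple R -> T j -> R ;
  parents_acyclic : acyclic parents ;
  mech_measurable : forall e j, measurable_fun [set: (#|parents j|.-tuple R * T j)%type]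
    (fun xu => @mech e j xu.1 xu.2) ;
  mech_Y : forall e, @mech e (node_Y d) = @mech ord0 (node_Y d) }.

Arguments mech {R d k dU T} s e j _ _.

Section structural_model.
Context (R : realType) (d k : nat) (dU : 'I_d.+1 -> measure_display)
  (T : forall j, measurableType (dU j)) (M : scm R k T).

Definition intervened : {set 'I_d.+1} :=
  [set j | (j != node_Y d) &&
           `[< exists e, mech M e j <> mech M ord0 j >]]%SET.

Definition Istar : {set 'I_d.+1} :=
  [set j | (j \in ch (parents M) (node_Y d)) &&
           [disjoint at_ (parents M) j & ch (parents M) (node_Y d)]]%SET.

(* [unlift (node_E d)] is the partial inverse of [node_up]: it sends the node
   d+2 to None. *)
Definition aug_pa (j : 'I_d.+2) : {set 'I_d.+2} :=
  [set i | match unlift (node_E d) i, unlift (node_E d) j with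
           | Some i', Some j' => i' \in parents M j'
           | None, Some j' => j' \in intervened
           | _, None => false
           end]%SET.

Context dO (Omega : measurableType dO) (P : probability Omega R).
Variables (U : forall j, {mfun Omega >-> T j}) (UE : Omega -> 'I_k.+1).

(* UE is U_{d+2}. *)
Record exogenous : Prop := Exogenous {
  U_indep : forall B : forall j, set (T j), (forall j, measurable (B j)) ->
    P (\bigcap_j (U j @^-1` B j)) = (\prod_j P (U j @^-1` B j))%E ;
  UE_measurable : forall e, measurable (UE @^-1` [set e]) ;
  UE_uniform : forall e, P (UE @^-1` [set e]) = (k.+1%:R^-1)%:E ;
  UE_indep : forall (B : forall j, set (T j)) e, (forall j, measurable (B j)) ->
    P (\bigcap_j (U j @^-1` B j) `&` UE @^-1` [set e]) =
    (P (\bigcap_j (U j @^-1` B j)) * P (UE @^-1` [set e]))%E }.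

Definition env_solution (e : 'I_k.+1) (Z : Omega -> d.+1.-tuple R) : Prop :=
  forall w j, tnth (Z w) j = mech M e j (coords (parents M j) (Z w)) (U j w).

(* The solution of the augmented model; the environment is embedded into R. *)
Definition aug_solution (Z : Omega -> d.+2.-tuple R) : Prop :=
  forall w, tnth (Z w) (node_E d) = (UE w : nat)%:R /\
    forall j, tnth (Z w) (node_up j) =
      mech M (if j \in intervened then UE w else ord0) j
        (coords (parents M j) [tuple tnth (Z w) (node_up i) | i < d.+1]) (U j w).

Definition env_law (Z : 'I_k.+1 -> {mfun Omega >-> d.+1.-tuple R})
  (e : 'I_k.+1) : probability (d.+1.-tuple R) R := distribution P (Z e).

Definition aug_law (Z : {mfun Omega >-> d.+2.-tuple R}) :
  probability (d.+2.-tuple R) R := distribution P Z.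

Definition faithful (mu : probability (d.+2.-tuple R) R) : Prop :=
  forall A B C : {set 'I_d.+2},
    [disjoint A & B]%B -> [disjoint A & C]%B -> [disjoint B & C]%B ->
    cond_indep mu (@coords R _ A) (@coords R _ B) (@coords R _ C) ->
    d_separated aug_pa A B C.

End structural_model.

Section regressions.
Context (R : realType) (d k : nat).
Variables (mu : 'I_k.+1 -> probability (d.+1.-tuple R) R)
  (m : 'I_k.+1 -> forall S : {set 'I_d.+1}, #|S|.-tuple R -> R).

Definition marginal (nu : probability (d.+1.-tuple R) R) (S : {set 'I_d.+1}) :
  probability (#|S|.-tuple R) R := distribution nu (@coords R _ S).

Definition rho (S : {set 'I_d.+1}) (e : 'I_k.+1) : #|S|.-tuple R -> \bar R :=
  ('d (charge_of_finite_measure (marginal (mu e) S))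
   '/d (marginal (mixture mu) S)).

Definition mbar (S : {set 'I_d.+1}) (x : #|S|.-tuple R) : R :=
  k.+1%:R^-1 * \sum_(e < k.+1) fine (rho e x) * m e x.

Definition envs_differ (S : {set 'I_d.+1}) : Prop :=
  exists e e', (0 < meet (mu e) (mu e')
    [set z | m e (coords S z) <> m e' (coords S z)])%E.

Definition mbar_differs (Sstar S : {set 'I_d.+1}) (mstar : #|Sstar|.-tuple R -> R)
  : Prop :=
  (0 < mixture mu [set z | mstar (coords Sstar z) <>
                           mbar (coords (S :|: Sstar)%SET z)])%E.

Definition identifiable (Sstar : {set 'I_d.+1}) (mstar : #|Sstar|.-tuple R -> R)
  : Prop :=
  forall S : {set 'I_d.+1}, node_Y d \notin S ->
    mbar_differs S mstar -> envs_differ S.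

End regressions.

(* Main.v *)
Require Import Defs.
From HB Require Import structures.
From mathcomp Require Import all_boot all_order all_algebra.
From mathcomp Require Import all_classical all_reals all_analysis.
From mathcomp Require Import measurable_realfun.

Set Implicit Arguments.
Unset Strict Implicit.
Unset Printing Implicit Defensive.

Import Order.TTheory GRing.Theory Num.Theory.
Import numFieldNormedType.Exports.

Local Open Scope classical_set_scope.
Local Open Scope ring_scope.

(* Sufficiency. If no element of S descends from Y, then X_(S u S* ) is a
   function of exogenous variables independent of U_Y, so conditioning Y on it
   amounts to integrating out U_Y in f_Y; hence m^(e, S u S* ) = m* for all e and
   mbar^(S u S* ) = m*.  Otherwise some c in I* has a descendant in S or lies in
   S; as I* is contained in I, the path E -> c <- Y is active given S, and
   faithfulness and (a) apply.

   Necessity. Let j be in I* but not in I, and let N be the vector of the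
   variables other than Y among the parents of j and of Y.  Since j is in I*, N
   consists of nondescendants of Y, so it is independent of (U_Y, U_j), and
   (N, Y, X_j) is the same function of (N, U_Y, U_j) in all environments.
   Fubini then expresses the regression of Y on X_S = (N, X_j) fibrewise: for
   almost every n it is determined by the law of (U_Y, U_j) alone, so
   m^(e, S) and m^(e', S) agree except where N falls in a null set of the one
   or the other environment, which the meet of the two laws does not charge. *)

(** * Ancestors and children in an acyclic graph *)

Section graph_lemmas.
Variables (V : finType) (pa : V -> {set V}).

Lemma parent_at i k : i \in pa k -> i \in at_ pa k.
Proof. by move=> ik; rewrite at_rec inE ik. Qed.

Lemma at_parent i j k : i \in at_ pa j -> j \in pa k -> i \in at_ pa k.
Proof.
by move=> ij jk; rewrite at_rec inE; apply/orP; right; apply/bigcupP; exists j.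
Qed.

Lemma at_trans i j k : i \in at_ pa j -> j \in at_ pa k -> i \in at_ pa k.
Proof.
move=> ij; rewrite [j \in _]inE => /exists_inP[l lk /connectP[p]].
elim/last_ind: p k l lk => [|p b IH] k l lk.
  by move=> _ /= lj; apply: at_parent ij _; rewrite -lj.
rewrite last_rcons rcons_path => /andP[jp pb] lb; subst b.
apply: at_parent lk.
exact: IH pb jp erefl.
Qed.

(** The child is the second node of a directed path from [k] to [s]. *)
Lemma at_child k s : k \in at_ pa s ->
  exists2 c, c \in ch pa k & (c == s) || (c \in at_ pa s).
Proof.
rewrite inE => /exists_inP[l ls /connectP[p]].
elim/last_ind: p s l ls => [|p b IH] s l ls.
  by move=> _ /= lk; exists s; rewrite ?eqxx// inE -lk.
rewrite last_rcons rcons_path => /andP[kp pb] lb; subst b.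
have [c ck cl] := IH _ _ pb kp erefl.
exists c => //; apply/orP; right; case/orP: cl => [/eqP->|cl].
  exact: parent_at.
exact: at_parent cl ls.
Qed.

Hypothesis pa_acyclic : acyclic pa.

(** Strictness is acyclicity at [i]. The cardinal of [at_] thus serves as a rank for inductions
    along edges. *)
Lemma at_proper i k : i \in at_ pa k -> at_ pa i \proper at_ pa k.
Proof.
move=> ik; apply/properP; split; last by exists i => //; exact: pa_acyclic.
by apply/fintype.subsetP => l li; exact: at_trans li ik.
Qed.

Lemma parent_ind (Q : V -> Prop) :
  (forall k, (forall i, i \in pa k -> Q i) -> Q k) -> forall k, Q k.
Proof.
move=> IH k; have [n] := ubnP #|at_ pa k|; elim: n k => // n IHn k.
rewrite ltnS => kn; apply: IH => i /parent_at/at_proper/proper_card ik.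
exact/IHn/(leq_trans ik).
Qed.

(** Replace [c] by a child of [k] among its ancestors as long as there is one; the number of
    ancestors drops each time. For [k] the node Y, the descent ends in [Istar]. *)
Lemma first_child k c : c \in ch pa k ->
  exists c', [/\ c' \in ch pa k, [disjoint at_ pa c' & ch pa k]%B &
    (c' == c) || (c' \in at_ pa c)].
Proof.
have [n] := ubnP #|at_ pa c|; elim: n c => // n IH c; rewrite ltnS => cn ck.
have [dis|] := boolP [disjoint at_ pa c & ch pa k]%B; first by exists c; rewrite eqxx.
case/pred0Pn => b /andP[/= bc bk].
have [|c' [c'k dis c'b]] := IH b _ bk.
  exact: leq_trans (proper_card (at_proper bc)) cn.
exists c'; split => //; apply/orP; right.
by case/orP: c'b => [/eqP->//|c'b]; exact: at_trans c'b bc.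
Qed.

(** A path from [k] to [i] would start with a child of [k], which would then be an ancestor of
    [j]. *)
Lemma disjoint_ch_notin_at i j k : [disjoint at_ pa j & ch pa k]%B ->
  i \in at_ pa j -> k \notin at_ pa i.
Proof.
move=> /pred0P dis ij; apply/negP => /at_child[c ck ci].
have : c \in at_ pa j.
  by case/orP: ci => [/eqP->//|ci]; exact: at_trans ci ij.
by move=> cj; have /= := dis c; rewrite cj ck.
Qed.

End graph_lemmas.

(** * Independence of generated sigma-algebras *)

Section independence.
Local Open Scope ereal_scope.
Context d (T : measurableType d) (R : realType) (P : probability T R).

(** As functions of [A], both sides are finite measures that agree on the pi-system [G], hence on
    the sigma-algebra it generates. *)
Lemma indep_sigma1 (G : set (set T)) (B : set T) :
  G `<=` measurable -> setI_closed G -> G setT -> measurable B ->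
  (forall A, G A -> P (A `&` B) = P A * P B) ->
  forall A, <<s G >> A -> P (A `&` B) = P A * P B.
Proof.
move=> Gm GI GT mB GB A GA.
have PB : P B = (fine (P B))%:E by rewrite fineK// fin_num_measure.
have fPB : (0 <= fine (P B))%R by rewrite fine_ge0.
rewrite PB [RHS]muleC.
have := @g_sigma_algebra_measure_unique _ R T G Gm (fun=> setT) _ _
  (mrestr P mB) (mscale (NngNum fPB) P) GI.
apply => //.
- by rewrite bigcup_const.
- move=> C GC; rewrite [LHS]GB// [X in _ * X]PB muleC; reflexivity.
- by move=> _; rewrite /= /mrestr setTI (le_lt_trans (probability_le1 _ mB))// ltry.
Qed.

Lemma indep_sigma (G H : set (set T)) :
  G `<=` measurable -> setI_closed G -> G setT ->
  H `<=` measurable -> setI_closed H -> H setT ->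
  (forall A B, G A -> H B -> P (A `&` B) = P A * P B) ->
  forall A B, <<s G >> A -> <<s H >> B -> P (A `&` B) = P A * P B.
Proof.
move=> Gm GI GT Hm HI HT GH A B GA HB.
have mA : measurable A.
  by move: A GA; apply: smallest_sub => //; exact: sigma_algebra_measurable.
rewrite setIC muleC; apply: (indep_sigma1 (G := H)) => // C HC.
rewrite setIC muleC; apply: (indep_sigma1 (G := G)) => //; first exact: Hm.
by move=> D GD; exact: GH.
Qed.

End independence.

(** * Sigma-algebras generated by groups of exogenous variables *)

Section exogenous_algebra.
Context (R : realType) (d k : nat) (dU : 'I_d.+1 -> measure_display)
  (T : forall j, measurableType (dU j)) (M : scm R k T).
Context dO (Omega : measurableType dO) (P : probability Omega R).
Variables (U : forall j, {mfun Omega >-> T j}) (UE : Omega -> 'I_k.+1).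
Hypothesis hU : exogenous P U UE.

Definition exo_cylinders (A : {set 'I_d.+1}) : set (set Omega) :=
  [set X | exists2 B : forall j, set (T j), (forall j, measurable (B j)) &
    X = \bigcap_(j in [set` A]) (U j @^-1` B j)].

(** [U_indep] constrains all nodes at once, so a cylinder over [A] is padded with full sets. *)
Let cylindersE (A : {set 'I_d.+1}) (B : forall j, set (T j)) :
  \bigcap_(j in [set` A]) (U j @^-1` B j) =
  \bigcap_j (U j @^-1` (if j \in A then B j else setT)).
Proof.
apply/seteqP; split => w Bw j /=; first by move=> _; case: ifP => // /Bw.
by move=> jA; have := Bw j I; rewrite /= jA.
Qed.

Lemma exo_cylinders_measurable A : exo_cylinders A `<=` measurable.
Proof.
move=> _ [B mB ->]; apply: fin_bigcap_measurable => // j _.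
exact: measurable_funPTI.
Qed.

Lemma exo_cylinders_setI A : setI_closed (exo_cylinders A).
Proof.
move=> _ _ [B mB ->] [C mC ->]; exists (fun j => B j `&` C j).
  by move=> j; exact: measurableI.
by rewrite -bigcapI.
Qed.

Lemma exo_cylinders_setT A : exo_cylinders A setT.
Proof.
by exists (fun=> setT) => //; apply/seteqP; split.
Qed.

(** By [indep_sigma] cylinders suffice. There the product over all nodes splits, since at each node
    one of the two padded sets is full. *)
Lemma exo_sigma_indep (A1 A2 : {set 'I_d.+1}) (X Y : set Omega) :
  [disjoint A1 & A2]%B ->
  <<s exo_cylinders A1 >> X -> <<s exo_cylinders A2 >> Y ->
  P (X `&` Y) = (P X * P Y)%E.
Proof.
move=> dis; apply: indep_sigma; try exact: exo_cylinders_measurable;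
  try exact: exo_cylinders_setI; try exact: exo_cylinders_setT.
move=> _ _ [B mB ->] [C mC ->]; rewrite !cylindersE -bigcapI.
pose B' j := if j \in A1 then B j else setT.
pose C' j := if j \in A2 then C j else setT.
have mB' j : measurable (B' j) by rewrite /B'; case: ifP.
have mC' j : measurable (C' j) by rewrite /C'; case: ifP.
rewrite (U_indep hU mB') (U_indep hU mC').
transitivity (P (\bigcap_j (U j @^-1` (B' j `&` C' j)))) => //.
rewrite (U_indep hU); last by move=> j; exact: measurableI.
rewrite -big_split /=; apply: eq_bigr => j _.
have [jA|jA] := boolP (j \in A1).
  have -> : C' j = setT by rewrite /C' (disjointFr dis jA).
  by rewrite setIT preimage_setT probability_setT mule1.
have -> : B' j = setT by rewrite /B' (negbTE jA).
by rewrite setTI preimage_setT probability_setT mul1e.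
Qed.

(** [Omega] with the sigma-algebra of the [U j], [j] in [A]: measurability on it encodes dependence
    on these variables alone. *)
Definition exo_space A := g_sigma_algebraType (exo_cylinders A).

Lemma exo_measurable_fun (A : {set 'I_d.+1}) j : j \in A ->
  measurable_fun [set: exo_space A] (U j : exo_space A -> T j).
Proof.
move=> jA _ B mB; rewrite setTI; apply: sub_sigma_algebra.
(* The family equal to [B] at [j] and full elsewhere; the transport is forced by the dependent type
   [T i]. *)
exists (fun i => [set t | forall e : i = j, B (eq_rect i T t j e)]).
  move=> i; have [ij|/eqP ij] := eqVneq i j.
    subst i; rewrite (_ : [set t | _] = B)//.
    apply/seteqP; split => [t /(_ erefl)//|t Bt e].
    by rewrite (eq_irrelevance e erefl).
  rewrite (_ : [set t | _] = setT)//.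
  by apply/seteqP; split => // t _ e.
apply/seteqP; split => [w Bw i _ /= e|w Bw]; last exact: Bw jA erefl.
by subst i.
Qed.

(** Induction along parents: the structural equation makes the coordinate [j] a measurable function
    of [U j] and of its parents, which stay in [A]. *)
Lemma ancestral_measurable_fun (A : {set 'I_d.+1}) e (Z : Omega -> d.+1.-tuple R) :
  env_solution M U e Z ->
  (forall i j, i \in parents M j -> j \in A -> i \in A) ->
  forall j, j \in A ->
    measurable_fun [set: exo_space A] ((fun w => tnth (Z w) j) : exo_space A -> R).
Proof.
move=> ZE Acl j; elim/(parent_ind (@parents_acyclic _ _ _ _ _ M)): j => j IH jA.
rewrite (_ : (fun w => _) = (fun xu => mech M e j xu.1 xu.2) \o
    (fun w => (coords (parents M j) (Z w), U j w))); last first.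
  by apply/funext => w; rewrite /= ZE.
apply: measurableT_comp; first exact: mech_measurable.
apply/measurable_fun_pairP; split => /=; last exact: exo_measurable_fun.
apply/measurable_fun_tnthP => i.
rewrite (_ : _ \o _ = fun w => tnth (Z w) (enum_val i)).
  by apply: IH; [exact: enum_valP|apply: Acl jA; exact: enum_valP].
by apply/funext => w /=; rewrite tnth_mktuple.
Qed.

End exogenous_algebra.

(** * Independent pairs and fibrewise conditioning *)

Section product_law.
Local Open Scope ereal_scope.
Context dO d1 d2 (Omega : measurableType dO) (T1 : measurableType d1)
  (T2 : measurableType d2) (R : realType) (P : probability Omega R).
Variables (N : {mfun Omega >-> T1}) (V : {mfun Omega >-> T2}).

Definition pair_rv (w : Omega) : T1 * T2 := (N w, V w).

Let measurable_pair_rv : measurable_fun [set: Omega] pair_rv.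
Proof. exact: measurable_fun_pair. Qed.

HB.instance Definition _ :=
  isMeasurableFun.Build _ _ _ _ pair_rv measurable_pair_rv.

Hypothesis NV : forall A B, measurable A -> measurable B ->
  P (N @^-1` A `&` V @^-1` B) = P (N @^-1` A) * P (V @^-1` B).

Let la := distribution P N.
Let nu := distribution P V.

Lemma product_lawE X : measurable X -> (la \x nu) X = distribution P pair_rv X.
Proof. by apply: product_measure_unique => A B mA mB; exact: NV. Qed.

Lemma integral_product_law (F : T1 * T2 -> R) : measurable_fun setT F ->
  P.-integrable setT (EFin \o (F \o pair_rv)) ->
  (la \x nu).-integrable setT (EFin \o F) /\
  \int[la \x nu]_x (F x)%:E = \int[P]_w (F (pair_rv w))%:E.
Proof.
move=> mF iF.
have mEF : measurable_fun [set: T1 * T2] (fun x => (F x)%:E) by exact/measurable_EFinP.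
have tr (G : T1 * T2 -> \bar R) :
    \int[la \x nu]_x G x = \int[distribution P pair_rv]_x G x.
  by apply: eq_measure_integral => A mA _; exact: product_lawE.
split; last by rewrite tr integral_distribution.
apply/integrableP; split => //.
rewrite tr ge0_integral_distribution//=; last first.
  by apply/measurable_EFinP; exact: measurableT_comp.
by case/integrableP : iF.
Qed.

Lemma ae_distribution (Q : T1 -> Prop) : {ae la, forall n, Q n} ->
  {ae P, forall w, Q (N w)}.
Proof.
move=> [A [mA A0 QA]]; exists (N @^-1` A); split => //.
  exact: measurable_funPTI.
by move=> w /= Qw; apply: QA.
Qed.

(* If g(N, V) determines N, conditioning on g(N, V) can be done fibrewise in N. *)
Lemma ae_fibre_cond_exp d3 (T3 : measurableType d3) (X : {mfun Omega >-> T3})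
    (W : Omega -> R) (m : T3 -> R) (f : T1 * T2 -> R) (g : T1 * T2 -> T3)
    (p : T3 -> T1) (D : set T3) :
  measurable_fun setT f -> measurable_fun setT g -> measurable_fun setT p ->
  measurable D ->
  (forall x, p (g x) = x.1) ->
  (forall w, W w = f (pair_rv w)) -> (forall w, X w = g (pair_rv w)) ->
  P.-integrable setT (EFin \o W) -> is_cond_exp P X W m ->
  {ae la, forall n,
     nu.-integrable setT
       (fun v => (\1_D (g (n, v)) * (f (n, v) - m (g (n, v))))%:E) /\
     \int[nu]_v (\1_D (g (n, v)) * (f (n, v) - m (g (n, v))))%:E = 0}.
Proof.
move=> mf mg mp mD pg Wf Xg iW [mm im mE].
(* Along [(N, V)], [psi E] is the residual [W - m(X)] cut to the event that [X] is in [E], so it has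
   mean zero for every measurable [E]. *)
pose psi E (x : T1 * T2) : R := (\1_E (g x) * (f x - m (g x)))%R.
have mpsi E : measurable E -> measurable_fun [set: T1 * T2] (psi E).
  move=> mE'; apply: measurable_funM; first exact: measurableT_comp.
  by apply: measurable_funB => //; exact: measurableT_comp.
have psiP E : EFin \o (psi E \o pair_rv) =
    (fun w => ((W w)%:E - (m (X w))%:E)) \_ (X @^-1` E).
  apply/funext => w /=; rewrite patchE /psi -Xg -Wf indicE.
  rewrite (_ : (w \in X @^-1` E) = (X w \in E)); last first.
    by apply/idP/idP; rewrite !inE.
  by case: (X w \in E); rewrite ?mul1r ?mul0r.
have mX E : measurable E -> measurable (X @^-1` E).
  by move=> mE'; rewrite -[X in measurable X]setTI; exact: measurable_funP.
have ipsi E : measurable E -> P.-integrable setT (EFin \o (psi E \o pair_rv)).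
  move=> mE'; rewrite psiP; apply/integrable_restrict => //; first exact: mX.
  rewrite setTI; apply: (integrableS measurableT) => //; first exact: mX.
  exact: integrableB.
have psi0 E : measurable E -> \int[la \x nu]_x (psi E x)%:E = 0.
  move=> mE'; have [_ ->] := integral_product_law (mpsi _ mE') (ipsi _ mE').
  rewrite -[LHS]/(\int[P]_w (EFin \o (psi E \o pair_rv)) w) psiP.
  rewrite -integral_mkcond integralB//; first last.
  - by apply: (integrableS measurableT) => //; exact: mX.
  - by apply: (integrableS measurableT) => //; exact: mX.
  - exact: mX.
  rewrite mE// subee//.
  apply: integrable_fin_num; first exact: mX.
  by apply: (integrableS measurableT) => //; exact: mX.
have [ipsiD _] := integral_product_law (mpsi _ mD) (ipsi _ mD).
have F0 : ae_eq la setT (fubini_F nu (EFin \o psi D)) (cst 0).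
  apply: integral_ae_eq => //; first exact: integrable_fubini_F.
  move=> C _ mC; rewrite integral0.
  have mE' : measurable (p @^-1` C `&` D).
    by apply: measurableI => //; rewrite -[X in measurable X]setTI; exact: mp.
  rewrite -[RHS](psi0 _ mE') -integral12_prod_meas1; last first.
    by have [] := integral_product_law (mpsi _ mE') (ipsi _ mE').
  rewrite integral_mkcond; apply: eq_integral => n _; rewrite patchE.
  have pC v : (g (n, v) \in p @^-1` C) = (n \in C).
    by apply/idP/idP; rewrite !inE /= pg.
  case: ifPn => nC; rewrite /fubini_F.
    apply: eq_integral => v _ /=; congr (_ * _)%:E.
    by rewrite !indicE in_setI pC nC.
  rewrite integral0_eq// => v _ /=.
  by rewrite /psi indicE in_setI pC (negbTE nC) mul0r.
have i1 := ae_integrable1 ipsiD.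
apply: filterS2 F0 i1 => n /(_ I) /= n0 n1; split => //.
Qed.

End product_law.

(** * Regression functions under a law, read on the sample space *)

Section cond_exp_distribution.
Local Open Scope ereal_scope.
Context dO d1 d2 (Omega : measurableType dO) (T1 : measurableType d1)
  (T2 : measurableType d2) (R : realType) (P : probability Omega R).

Lemma is_cond_exp_distribution (Z : {mfun Omega >-> T1}) (X : {mfun T1 >-> T2})
    (W : T1 -> R) (m : T2 -> R) :
  measurable_fun setT W -> P.-integrable setT (fun w => (W (Z w))%:E) ->
  is_cond_exp (distribution P Z) X W m ->
  is_cond_exp P (X \o Z) (fun w => W (Z w)) m.
Proof.
move=> mW iW [mm im mE].
have mmX : measurable_fun setT (fun z => (m (X z))%:E).
  by apply/measurable_EFinP; exact: measurableT_comp.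
have iP : P.-integrable setT (fun w => (m (X (Z w)))%:E).
  apply/integrableP; split.
    by apply/measurable_EFinP; do 2 apply: measurableT_comp => //.
  case/integrableP : im => _; rewrite ge0_integral_distribution//.
  exact: measurableT_comp.
have mEW : measurable_fun setT (fun z => (W z)%:E) by exact/measurable_EFinP.
split => // B mB.
have mXB : measurable (X @^-1` B).
  exact: measurable_funPTI.
have mZXB : measurable (Z @^-1` (X @^-1` B)).
  exact: measurable_funPTI.
have := mE B mB; rewrite integral_pushforward//; last exact: integrableS iP.
by rewrite integral_pushforward//; exact: integrableS iW.
Qed.

End cond_exp_distribution.

(** * The meet of two probability measures *)

Section meet_lemmas.
Local Open Scope ereal_scope.
Local Open Scope charge_scope.
Context d (T : measurableType d) (R : realType).

Lemma mixture_dominates k (mu : 'I_k.+1 -> probability T R) e :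
  mu e `<< mixture mu.
Proof.
apply/null_content_dominatesP => A mA /eqP.
rewrite /mixture mule_eq0 => /orP[|].
  by rewrite eqe invr_eq0 pnatr_eq0.
by rewrite seq_psume_eq0// => /allP/(_ e (mem_index_enum _))/eqP.
Qed.

Lemma integrable_mine (mu : {measure set T -> \bar R}) (f g : T -> \bar R) :
  mu.-integrable setT f -> mu.-integrable setT g ->
  mu.-integrable setT (fun x => mine (f x) (g x)).
Proof.
move=> itf itg; apply: (@le_integrable _ _ _ _ _ measurableT _
  (fun x => `|f x| + `|g x|)).
- by apply: measurable_mine; [exact: measurable_int itf|exact: measurable_int itg].
- move=> x _; rewrite [leRHS]gee0_abs ?adde_ge0//.
  by rewrite /mine; case: ifP => _; rewrite ?leeDl ?leeDr.
- by apply: integrableD => //; exact: integrable_abse.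
Qed.

(** The minimum of the densities is bounded by the first on [A]&[B] and by the second on [A]\[B].
    Hence [A] has meet zero as soon as some [B] splits it into a [mu]-null and a [nu]-null part. *)
Lemma meet_le (mu nu : probability T R) (A B : set T) :
  measurable A -> measurable B ->
  meet mu nu A <= mu (A `&` B) + nu (A `\` B).
Proof.
move=> mA mB; rewrite /meet; set fam := fun i : 'I_2 => _; set la := mixture fam.
have mula : mu `<< la by exact: (@mixture_dominates 1 fam ord0).
have nula : nu `<< la by exact: (@mixture_dominates 1 fam ord_max).
have imu := Radon_Nikodym_integrable (nu := charge_of_finite_measure mu) mula.
have inu := Radon_Nikodym_integrable (nu := charge_of_finite_measure nu) nula.
have imin := integrable_mine imu inu.
have mAB : measurable (A `&` B) by exact: measurableI.
have mADB : measurable (A `\` B) by exact: measurableD.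
have {1}-> : A = (A `&` B) `|` (A `\` B) by rewrite setDE -setIUr setUv setIT.
rewrite integral_setU//; first last.
- by apply/disj_setPS => x [[_ Bx] [_]]; exact.
- by apply: measurable_funTS; exact: measurable_int imin.
apply: leeD.
- have -> : mu (A `&` B) = _ :=
    Radon_Nikodym_integral (nu := charge_of_finite_measure mu) mula mAB.
  apply: (le_integral mAB); try by apply: (integrableS measurableT).
  by move=> x _; rewrite ge_min lexx.
- have -> : nu (A `\` B) = _ :=
    Radon_Nikodym_integral (nu := charge_of_finite_measure nu) nula mADB.
  apply: (le_integral mADB); try by apply: (integrableS measurableT).
  by move=> x _; rewrite ge_min lexx orbT.
Qed.

End meet_lemmas.

(** * Sets on which two functions differ *)

Section measurable_comparison.
Context d (T : measurableType d) (R : realType) (f g : T -> R).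
Hypotheses (mf : measurable_fun setT f) (mg : measurable_fun setT g).

Lemma measurable_ltr_set : measurable [set x | f x < g x].
Proof.
rewrite (_ : [set x | _] = setT `&` (fun x => f x < g x) @^-1` [set true]).
  exact: measurable_fun_ltr.
by rewrite setTI.
Qed.

Lemma measurable_neq_set : measurable [set x | f x <> g x].
Proof.
rewrite (_ : [set x | _] = setT `&` (fun x => f x == g x) @^-1` [set false]).
  exact: measurable_fun_eqr.
rewrite setTI; apply/seteqP; split => [x /= /eqP/negbTE//|x /= fg /eqP].
by rewrite fg.
Qed.

End measurable_comparison.

Section uniqueness.
Local Open Scope ereal_scope.
Context d (T : measurableType d) (R : realType) (nu : probability T R).

(** The integrand is nonnegative, and positive exactly on the set in question. *)
Lemma integral_gt0_null (f g : T -> R) :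
  measurable_fun setT f -> measurable_fun setT g ->
  nu.-integrable setT (fun v => (\1_[set v | (f v < g v)%R] v * (g v - f v))%:E) ->
  \int[nu]_v (\1_[set v | (f v < g v)%R] v * (g v - f v))%:E = 0 ->
  nu [set v | (f v < g v)%R] = 0.
Proof.
move=> mf mg ih h0; set h := fun v => _ in ih h0.
have memE v : (v \in [set v | (f v < g v)%R]) = (f v < g v)%R.
  by apply/idP/idP; rewrite inE.
have hE v : `|h v| = h v.
  rewrite gee0_abs// lee_fin indicE memE.
  by have [fg|_] := boolP (f v < g v)%R; rewrite ?mul0r// mul1r subr_ge0 ltW.
have : ae_eq nu setT h (cst 0).
  apply/ae_eq_integral_abs => //; first exact: measurable_int ih.
  by rewrite -[RHS]h0; apply: eq_integral => v _; rewrite hE.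
case=> A [mA A0 hA]; apply/eqP; rewrite -measure_le0 -A0 le_measure ?inE//.
  exact: measurable_ltr_set.
move=> v /= fg; apply: hA => /= /(_ I)/eqP; rewrite eqe indicE memE fg mul1r.
by rewrite subr_eq0 gt_eqF.
Qed.

End uniqueness.

(** * Comparison of two regression functions *)

Section cond_exp_comparison.
Local Open Scope ereal_scope.
Context dO d1 d2 (Omega : measurableType dO) (T1 : measurableType d1)
  (T2 : measurableType d2) (R : realType) (P : probability Omega R).
Variable V : {mfun Omega >-> T2}.

(** Since [V] is independent of [N], both sides are the mean of [f (N' w, v)] over the law of [V]:
    what [N] contains beyond [N'] has no effect on the regression. *)
Lemma cond_exp_coarsen d3 (T3 : measurableType d3)
    (N : {mfun Omega >-> T1}) (N' : {mfun Omega >-> T3}) (W : Omega -> R)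
    (q : T1 -> T3) (f : T3 * T2 -> R) (m : T1 -> R) (m' : T3 -> R) :
  (forall A B, measurable A -> measurable B ->
    P (N @^-1` A `&` V @^-1` B) = P (N @^-1` A) * P (V @^-1` B)) ->
  measurable_fun setT q -> measurable_fun setT f ->
  (forall w, N' w = q (N w)) -> (forall w, W w = f (N' w, V w)) ->
  P.-integrable setT (EFin \o W) ->
  is_cond_exp P N W m -> is_cond_exp P N' W m' ->
  {ae P, forall w, m (N w) = m' (N' w)}.
Proof.
move=> NV mq mf N'E WE iW cm cm'.
have N'V A B : measurable A -> measurable B ->
    P (N' @^-1` A `&` V @^-1` B) = P (N' @^-1` A) * P (V @^-1` B).
  move=> mA mB; rewrite (_ : N' @^-1` A = N @^-1` (q @^-1` A)); last first.
    by apply/seteqP; split => w /=; rewrite N'E.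
  by apply: NV => //; rewrite -[X in measurable X]setTI; exact: mq.
have fq : measurable_fun [set: T1 * T2] (fun x => f (q x.1, x.2)).
  apply: measurableT_comp => //; apply: measurable_fun_pair => //=.
  exact: measurableT_comp.
have WE' w : W w = f (q (N w), V w) by rewrite WE N'E.
(* Conditioning on [N] itself is the case [g = fst], [p = id]; [D = setT] gives the mean over the
   whole fibre. *)
have H1 := @ae_fibre_cond_exp _ _ _ _ _ _ _ _ N V NV _ T1 N W m
  (fun x => f (q x.1, x.2)) fst id setT fq measurable_fst (@measurable_id _ _ _)
  measurableT (fun=> erefl) WE' (fun=> erefl) iW cm.
have H2 := @ae_fibre_cond_exp _ _ _ _ _ _ _ _ N' V N'V _ T3 N' W m'
  f fst id setT mf measurable_fst (@measurable_id _ _ _)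
  measurableT (fun=> erefl) WE (fun=> erefl) iW cm'.
apply: filterS2 (ae_distribution H1) (ae_distribution H2).
move=> w /= [i1 e1] [i2 e2].
have := integralB measurableT i1 i2; rewrite e1 e2 sube0.
rewrite (eq_integral (fun=> (m' (N' w) - m (N w))%:E)); last first.
  move=> v _; rewrite !indicT !mul1r -N'E -EFinB.
  by rewrite opprB addrC addrA subrK.
rewrite integral_cst// [X in _ * X](probability_setT (distribution P V)).
rewrite mule1 => -[/eqP].
by rewrite subr_eq0 => /eqP.
Qed.

(** [f], [g] and the law of [V] are shared, only the laws of [N] and [N'] differ. In a fibre that is
    exceptional for neither, [m] and [m'] solve the same equations and agree almost surely. The set
    [B] has the form required by [meet_le]. *)
Lemma regressions_agree d3 (T3 : measurableType d3)
    (N N' : {mfun Omega >-> T1}) (X X' : {mfun Omega >-> T3})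
    (W W' : Omega -> R) (f : T1 * T2 -> R) (g : T1 * T2 -> T3) (p : T3 -> T1)
    (m m' : T3 -> R) :
  (forall A B, measurable A -> measurable B ->
    P (N @^-1` A `&` V @^-1` B) = P (N @^-1` A) * P (V @^-1` B)) ->
  (forall A B, measurable A -> measurable B ->
    P (N' @^-1` A `&` V @^-1` B) = P (N' @^-1` A) * P (V @^-1` B)) ->
  measurable_fun setT f -> measurable_fun setT g -> measurable_fun setT p ->
  (forall x, p (g x) = x.1) ->
  (forall w, W w = f (N w, V w)) -> (forall w, W' w = f (N' w, V w)) ->
  (forall w, X w = g (N w, V w)) -> (forall w, X' w = g (N' w, V w)) ->
  P.-integrable setT (EFin \o W) -> P.-integrable setT (EFin \o W') ->
  is_cond_exp P X W m -> is_cond_exp P X' W' m' ->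
  exists B : set T1, [/\ measurable B,
    P ([set w | m (X w) <> m' (X w)] `&` N @^-1` B) = 0 &
    P ([set w | m (X' w) <> m' (X' w)] `\` N' @^-1` B) = 0].
Proof.
move=> NV N'V mf mg mp pg Wf W'f Xg X'g iW iW' cm cm'.
have [mm _ _] := cm; have [mm' _ _] := cm'.
(* Testing [f - m] and [f - m'] against [D1] in one fibre and subtracting leaves the integral of
   [m' - m] over the set where it is positive; [D2] is symmetric. *)
pose D1 := [set x | m x < m' x]%R; pose D2 := [set x | m' x < m x]%R.
have mD1 : measurable D1 by exact: measurable_ltr_set.
have mD2 : measurable D2 by exact: measurable_ltr_set.
have fib D mD := ae_fibre_cond_exp NV (D := D) mf mg mp mD pg Wf Xg iW cm.
have fib' D mD := ae_fibre_cond_exp N'V (D := D) mf mg mp mD pg W'f X'g iW' cm'.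
have [C [mC C0 HC]] := filterI (fib _ mD1) (fib _ mD2).
have [C' [mC' C'0 HC']] := filterI (fib' _ mD1) (fib' _ mD2).
pose nu := distribution P V.
have mgn n : measurable_fun setT (fun v => g (n, v)).
  by apply: measurableT_comp => //; exact: measurable_pair1.
have nuD n (a b : T3 -> R) : measurable_fun setT a -> measurable_fun setT b ->
    let D := [set x | a x < b x]%R in
    let F c v := (\1_D (g (n, v)) * (f (n, v) - c (g (n, v))))%:E in
    nu.-integrable setT (F a) /\ \int[nu]_v F a v = 0 ->
    nu.-integrable setT (F b) /\ \int[nu]_v F b v = 0 ->
    nu [set v | a (g (n, v)) < b (g (n, v))]%R = 0.
  move=> ma mb D F [ia ea] [ib eb].
  have FE : (fun v => (\1_[set v | (a (g (n, v)) < b (g (n, v)))%R] v *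
      (b (g (n, v)) - a (g (n, v))))%:E) = (F a \- F b).
    apply/funext => v; rewrite /= /F -EFinB -mulrBr; congr ((_ * _)%:E).
    by rewrite opprB [RHS]addrC addrA subrK.
  apply: (@integral_gt0_null _ _ _ nu (fun v => a (g (n, v)))
    (fun v => b (g (n, v)))).
  - exact: measurableT_comp.
  - exact: measurableT_comp.
  - by rewrite FE; exact: integrableB.
  - by rewrite FE integralB// ea eb sube0.
have nu0 n : ~ C n -> ~ C' n -> nu [set v | m (g (n, v)) <> m' (g (n, v))] = 0.
  move=> nC nC'.
  have /contrapT[q1 q2] := fun q => nC (HC n q).
  have /contrapT[q1' q2'] := fun q => nC' (HC' n q).
  apply/eqP; rewrite -measure_le0.
  have <- : nu [set v | m (g (n, v)) < m' (g (n, v))]%R +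
      nu [set v | m' (g (n, v)) < m (g (n, v))]%R = 0.
    by rewrite (nuD _ _ _ mm mm' q1 q1') (nuD _ _ _ mm' mm q2' q2) adde0.
  rewrite (_ : [set v | _] = [set v | m (g (n, v)) < m' (g (n, v))]%R `|`
    [set v | m' (g (n, v)) < m (g (n, v))]%R); last first.
    apply/seteqP; split => v /= => [/eqP|[|]/lt_eqF/eqP//].
      by rewrite neq_lt => /orP.
    by move=> + /esym; exact.
  by apply: measureU2; apply: measurable_ltr_set; exact: measurableT_comp.
(* [C] is null for the law of [N] and [C'] for that of [N']. Inside this set, [N] is in [C] or
   outside both; off it, [N'] is in [C']. *)
exists (C `|` ~` C'); split.
- by apply: measurableU => //; exact: measurableC.
(* The disagreement over the good fibres: each section is null by [nu0] or empty, so [G] is null for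
   the product law. *)
- pose G := [set x | m (g x) <> m' (g x)] `&`
    ((~` C `&` ~` C') `*` [set: T2]).
  have mG : measurable G.
    apply: measurableI; first by apply: measurable_neq_set; exact: measurableT_comp.
    by apply: measurableX => //; apply: measurableI; exact: measurableC.
  have G0 : P (pair_rv N V @^-1` G) = 0.
    rewrite -[LHS]/(distribution P (pair_rv N V) G) -(product_lawE NV)//.
    rewrite /product_measure1 integral0_eq// => n _ /=.
    have [nC|nC] := pselect (C n).
      rewrite (_ : xsection G n = set0) ?measure0// -subset0 => v.
      by rewrite /xsection /= inE => -[_ [[]]].
    have [nC'|nC'] := pselect (C' n).
      rewrite (_ : xsection G n = set0) ?measure0// -subset0 => v.
      by rewrite /xsection /= inE => -[_ [[_]]].
    rewrite (_ : xsection G n = [set v | m (g (n, v)) <> m' (g (n, v))]).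
      exact: nu0.
    by apply/seteqP; split => v; rewrite /xsection /= inE // => -[].
  apply/eqP; rewrite -measure_le0.
  have <- : P (N @^-1` C) + P (pair_rv N V @^-1` G) = 0.
    by rewrite G0 adde0; exact: C0.
  have mNC : measurable (N @^-1` C) by exact: measurable_funPTI.
  have mNG : measurable (pair_rv N V @^-1` G) by exact: measurable_funPTI.
  apply: le_trans (measureU2 _ mNC mNG).
  apply: le_measure; rewrite ?inE; [|exact: measurableU|].
    apply: measurableI.
      by apply: measurable_neq_set; exact: measurableT_comp.
    apply: measurable_funPTI.
    by apply: measurableU => //; exact: measurableC.
  move=> w /= [neq CN]; have [?|nC] := pselect (C (N w)); [by left|right].
  split; first by rewrite /pair_rv /= -Xg.
  by split => //; split => //; case: CN.
- apply/eqP; rewrite -measure_le0 -[leRHS]C'0.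
  apply: le_measure; rewrite ?inE; [|exact: measurable_funPTI|].
    apply: measurableD.
      by apply: measurable_neq_set; exact: measurableT_comp.
    apply: measurable_funPTI.
    by apply: measurableU => //; exact: measurableC.
  by move=> w /= [_ /not_orP[_ /contrapT]].
Qed.

End cond_exp_comparison.

(** * The pooled regression *)

Section pooled_regression.
Local Open Scope ereal_scope.
Local Open Scope charge_scope.
Context (R : realType) (d k : nat).
Variables (mu : 'I_k.+1 -> probability (d.+1.-tuple R) R)
  (m : 'I_k.+1 -> forall S : {set 'I_d.+1}, #|S|.-tuple R -> R).

Lemma marginal_dominates (S : {set 'I_d.+1}) e :
  marginal (mu e) S `<< marginal (mixture mu) S.
Proof.
apply/null_content_dominatesP => A mA nuA0.
have /null_content_dominatesP := @mixture_dominates _ _ _ _ mu e.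
by apply => //; exact: measurable_funPTI.
Qed.

(** [mbar] averages the [m e] with weights [rho]. Where [m e] differs from [mstar] its weight
    vanishes, and the weights sum to [k.+1]. *)
Lemma mbar_invariant (S S0 : {set 'I_d.+1}) (r : #|S|.-tuple R -> #|S0|.-tuple R)
    (mstar : #|S0|.-tuple R -> R) :
  measurable_fun setT r -> measurable_fun setT mstar ->
  (forall e, measurable_fun setT (@m e S)) ->
  (forall z, coords S0 z = r (coords S z)) ->
  (forall e, mu e [set z | m e (coords S z) <> mstar (coords S0 z)] = 0) ->
  mixture mu [set z | mstar (coords S0 z) <> mbar mu m (coords S z)] = 0.
Proof.
move=> mr mms mm rE m0.
pose nu := marginal (mixture mu) S.
have imu e : nu.-integrable setT (rho mu (S := S) e).
  exact: (Radon_Nikodym_integrable (nu := charge_of_finite_measure (marginal (mu e) S)))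
    (@marginal_dominates S e).
have rhoE e A : measurable A -> marginal (mu e) S A = \int[nu]_(x in A) rho mu e x.
  exact: (Radon_Nikodym_integral (nu := charge_of_finite_measure (marginal (mu e) S)))
    (@marginal_dominates S e).
have rho_fin e x : rho mu (S := S) e x \is a fin_num.
  exact: (Radon_Nikodym_fin_num (nu := charge_of_finite_measure (marginal (mu e) S)))
    (@marginal_dominates S e).
pose A e := [set x | m e x <> mstar (r x)].
have mA e : measurable (A e).
  by apply: measurable_neq_set => //; exact: measurableT_comp.
have A0 e : marginal (mu e) S (A e) = 0.
  rewrite -(m0 e); congr (mu e _).
  by apply/seteqP; split => z /=; rewrite rE.
(* [A e] is null for environment [e] but perhaps not for the pooled law, so what must vanish there
   is the density. *)
have H1 e : ae_eq nu (A e) (rho mu e) (cst 0).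
  apply: integral_ae_eq; [exact: mA| |by []|].
    exact: (integrableS measurableT (mA e) (@subsetT _ _) (imu e)).
  move=> B BA mB; rewrite integral0 -rhoE//.
  apply/eqP; rewrite -measure_le0 -(A0 e).
  by apply: le_measure; rewrite ?inE; [exact: mB|exact: mA|exact: BA].
(* Both sides integrate over any [B] to the sum of the marginals, which is [k.+1] times the pooled
   marginal. *)
have H2 : ae_eq nu setT (fun x => \sum_(e < k.+1) rho mu e x)
    (cst k.+1%:R%:E).
  apply: integral_ae_eq => //; first exact: integrable_sum.
  move=> B _ mB; rewrite integral_sum//; last first.
    by move=> e; by apply: (integrableS measurableT).
  rewrite integral_cst//.
  rewrite (eq_bigr (fun e => marginal (mu e) S B)); last by move=> e _; rewrite rhoE.
  rewrite /nu /marginal /distribution /pushforward /= /mixture muleA -EFinM divff//.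
  by rewrite mul1e.
have {}H1 : {ae nu, forall x e, A e x -> rho mu e x = 0}.
  by apply: filter_forall => e; exact: H1.
have : {ae nu, forall x, mstar (r x) = mbar mu m x}.
  apply: filterS2 H1 H2 => x x0 /(_ I) x1.
  rewrite /mbar (eq_bigr (fun e => fine (rho mu e x) * mstar (r x))%R); last first.
    move=> e _; have [->//|/eqP/x0 ->] := eqVneq (m e x) (mstar (r x)).
    by rewrite !mul0r.
  rewrite -mulr_suml mulrA.
  have -> : (\sum_(e < k.+1) fine (rho mu e x) = k.+1%:R)%R.
    apply: EFin_inj; rewrite -sumEFin -[RHS]x1.
    by apply: eq_bigr => e _; rewrite fineK.
  by rewrite mulVf ?mul1r// pnatr_eq0.
move=> /ae_distribution H3.
apply/negligibleP.
  apply: measurable_neq_set.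
    by apply: measurableT_comp mms _; exact: measurable_coords.
  apply: measurable_funM => //; apply: measurable_sum => e.
  apply: measurable_funM.
    apply: measurableT_comp; first exact: fine_measurable.
    apply: measurableT_comp; last exact: measurable_coords.
    exact: measurable_int (imu e).
  by apply: measurableT_comp; [exact: mm|exact: measurable_coords].
case: H3 => N [mN N0 HN]; exists N; split => // z /= zN; apply: HN => /=.
by rewrite -rE.
Qed.

End pooled_regression.

(** * Coordinate projections and their sections *)

Section coordinates.
Context (R : realType) (n : nat).
Implicit Types (A S : {set 'I_n}) (z : n.-tuple R).

Lemma coords_eq S z z' :
  (forall i, i \in S -> tnth z i = tnth z' i) -> coords S z = coords S z'.
Proof.
move=> zz'; apply: eq_from_tnth => l; rewrite !tnth_mktuple.
by apply: zz'; exact: enum_valP.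
Qed.

(* At most one term of the sum is present; coordinates outside S are 0. *)
Definition extend S (x : #|S|.-tuple R) : n.-tuple R :=
  [tuple \sum_(l < #|S| | enum_val l == i) tnth x l | i < n].

Lemma coords_extend S (x : #|S|.-tuple R) : coords S (extend x) = x.
Proof.
apply: eq_from_tnth => l; rewrite !tnth_mktuple (big_pred1 l)// => l'.
by rewrite /= (inj_eq enum_val_inj).
Qed.

Lemma extend_coords S z i : i \in S -> tnth (extend (coords S z)) i = tnth z i.
Proof.
move=> iS; rewrite tnth_mktuple (big_pred1 (enum_rank_in iS i)) => [|l].
  by rewrite tnth_mktuple enum_rankK_in.
by rewrite /= -(inj_eq enum_val_inj) enum_rankK_in.
Qed.

(** Passing through the full vector expresses the projection from the coordinates in [S] to those in
    [A] without reindexing. *)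
Lemma coords_extend_coords A S z : A \subset S ->
  coords A (extend (coords S z)) = coords A z.
Proof.
by move=> AS; apply: coords_eq => i /(fintype.subsetP AS); exact: extend_coords.
Qed.

Lemma measurable_extend S : measurable_fun setT (@extend S).
Proof.
apply/measurable_fun_tnthP => i.
rewrite (_ : _ \o _ = fun x : #|S|.-tuple R =>
    \sum_(l < #|S|) (if enum_val l == i then tnth x l else 0)).
  apply: measurable_sum => l; case: (enum_val l == i) => //; exact: measurable_tnth.
by apply/funext => x /=; rewrite tnth_mktuple big_mkcond.
Qed.

Definition set_coord z (i : 'I_n) (x : R) : n.-tuple R :=
  [tuple if l == i then x else tnth z l | l < n].

Lemma tnth_set_coord z i x l :
  tnth (set_coord z i x) l = if l == i then x else tnth z l.
Proof. by rewrite tnth_mktuple. Qed.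

Lemma measurable_set_coord dT (T : measurableType dT) (z : T -> n.-tuple R) i
    (x : T -> R) : measurable_fun setT z -> measurable_fun setT x ->
  measurable_fun setT (fun t => set_coord (z t) i (x t)).
Proof.
move=> mz mx; apply/measurable_fun_tnthP => l.
rewrite (_ : _ \o _ = fun t => if l == i then x t else tnth (z t) l).
  by case: (l == i) => //; exact: measurableT_comp (measurable_tnth l) mz.
by apply/funext => t /=; rewrite tnth_set_coord.
Qed.

End coordinates.

(** * Regressions in the structural model *)

Section structural.
Context (R : realType) (d k : nat) (dU : 'I_d.+1 -> measure_display)
  (T : forall j, measurableType (dU j)) (M : scm R k T).
Context dO (Omega : measurableType dO) (P : probability Omega R).
Variables (U : forall j, {mfun Omega >-> T j}) (UE : Omega -> 'I_k.+1).
Hypothesis hU : exogenous P U UE.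
Variable Z : 'I_k.+1 -> {mfun Omega >-> d.+1.-tuple R}.
Hypothesis hZ : forall e, env_solution M U e (Z e).
Hypothesis hY2 : forall e,
  ('E_P[fun w => (`|tnth (Z e w) (node_Y d)| ^+ 2)%R] < +oo)%E.

Local Notation Y := (node_Y d).
Local Notation pa := (parents M).
Local Notation paY := (pa Y).

(** Y is excluded explicitly because [at_] contains proper ancestors only. *)
Definition nondesc : {set 'I_d.+1} :=
  [set l | (l != Y) && (Y \notin at_ pa l)]%SET.

Lemma mem_nondesc l : (l \in nondesc) = (l != Y) && (Y \notin at_ pa l).
Proof. by rewrite inE. Qed.

Lemma nondesc_ancestral i j : i \in pa j -> j \in nondesc -> i \in nondesc.
Proof.
move=> ij; rewrite !mem_nondesc => /andP[_ Yj]; apply/andP; split.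
  by apply: contraNneq Yj => <-; exact: parent_at.
by apply: contraNN Yj => Yi; exact: at_parent Yi ij.
Qed.

Lemma pa_nondesc : paY \subset nondesc.
Proof.
apply/fintype.subsetP => i iY; have YY := parents_acyclic M Y; rewrite mem_nondesc.
apply/andP; split; first by apply: contraNneq YY => {1}<-; exact: parent_at.
by apply: contraNN YY => Yi; exact: at_parent Yi iY.
Qed.

(** [nondesc] is closed under parents, so the coordinates in [S] depend on the exogenous variables
    of [nondesc] only, and [V] on those of [D]. *)
Lemma nondesc_indep e (S D : {set 'I_d.+1}) dV (TV : measurableType dV)
    (V : {mfun Omega >-> TV}) A B :
  S \subset nondesc -> [disjoint nondesc & D]%B ->
  measurable_fun [set: exo_space U D] (V : exo_space U D -> TV) ->
  measurable A -> measurable B ->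
  P ((@coords R _ S \o Z e) @^-1` A `&` V @^-1` B) =
  (P ((@coords R _ S \o Z e) @^-1` A) * P (V @^-1` B))%E.
Proof.
move=> Snd dis mV mA mB.
apply: (exo_sigma_indep hU dis).
  rewrite -[X in <<s _ >> X]setTI.
  have : measurable_fun [set: exo_space U nondesc]
      ((@coords R _ S \o Z e) : exo_space U nondesc -> _).
    apply/measurable_fun_tnthP => l.
    rewrite (_ : _ \o _ = fun w => tnth (Z e w) (enum_val l)).
      apply: (ancestral_measurable_fun (hZ e) nondesc_ancestral).
      exact/(fintype.subsetP Snd)/enum_valP.
    by apply/funext => w; rewrite /= tnth_mktuple.
  by apply.
by rewrite -[X in <<s _ >> X]setTI; exact: mV.
Qed.

(** Domination by the second moment: |y| <= 1 + |y|^2. *)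
Lemma integrable_Y e : P.-integrable setT (fun w => (tnth (Z e w) Y)%:E).
Proof.
have mY : measurable_fun setT (fun w => tnth (Z e w) Y).
  exact: measurableT_comp (measurable_tnth Y) (measurable_funP (Z e)).
have mY2 : measurable_fun setT (fun w => (`|tnth (Z e w) Y| ^+ 2)%R).
  by apply: measurable_funX; exact: measurableT_comp.
apply: (@le_integrable _ _ _ _ _ measurableT _
  (fun w => (1 + `|tnth (Z e w) Y| ^+ 2)%:E)%R).
- exact/measurable_EFinP.
- move=> w _; rewrite !abse_EFin lee_fin [leRHS]ger0_norm ?addr_ge0 ?exprn_ge0//.
  set y := `|_|; have [y1|y1] := leP y 1.
    by rewrite (le_trans y1)// lerDl exprn_ge0 ?normr_ge0.
  by apply: (le_trans (ler_eXnr (n := 2) isT (ltW y1))); rewrite lerDr.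
- rewrite (_ : (fun w => _) = (cst 1%:E \+ fun w => (`|tnth (Z e w) Y| ^+ 2)%:E)%E)//.
  apply: integrableD => //; first exact: finite_measure_integrable_cst.
  apply/integrableP; split; first exact/measurable_EFinP.
  under eq_integral do rewrite gee0_abs ?lee_fin ?exprn_ge0//.
  by have := hY2 e; rewrite unlock.
Qed.

Lemma cond_exp_env e (S : {set 'I_d.+1}) (m : #|S|.-tuple R -> R) :
  is_cond_exp (env_law P Z e) (@coords R _ S) (fun z => tnth z Y) m ->
  is_cond_exp P (@coords R _ S \o Z e) (fun w => tnth (Z e w) Y) m.
Proof.
apply: is_cond_exp_distribution; first exact: measurable_tnth.
exact: integrable_Y.
Qed.

Lemma mech_Y_eq e w : tnth (Z e w) Y = mech M ord0 Y (coords paY (Z e w)) (U Y w).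
Proof. by rewrite (hZ e) mech_Y. Qed.

(** The variables in [S] are independent of [U Y], and Y is a function of its parents and [U Y]:
    this is [cond_exp_coarsen] with [V] equal to [U Y]. *)
Lemma regression_nondesc e (S : {set 'I_d.+1}) (m : #|S|.-tuple R -> R)
    (mstar : #|paY|.-tuple R -> R) :
  paY \subset S -> S \subset nondesc ->
  is_cond_exp (env_law P Z e) (@coords R _ S) (fun z => tnth z Y) m ->
  is_cond_exp (env_law P Z e) (@coords R _ paY) (fun z => tnth z Y) mstar ->
  env_law P Z e [set z | m (coords S z) <> mstar (coords paY z)] = 0%E.
Proof.
move=> paS Snd cm cms; have [mm _ _] := cm; have [mms _ _] := cms.
have dis : [disjoint nondesc & [set Y]%SET]%B.
  by rewrite disjoint_sym disjoints1 mem_nondesc eqxx.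
have mq : measurable_fun setT (coords paY \o @extend R _ S).
  exact: measurableT_comp (@measurable_coords _ _ _) (@measurable_extend _ _ _).
have H := @cond_exp_coarsen _ _ _ _ _ _ _ P (U Y) _ _ (@coords R _ S \o Z e)
  (@coords R _ paY \o Z e) (fun w => tnth (Z e w) Y) (coords paY \o @extend R _ S)
  (fun x => mech M ord0 Y x.1 x.2) m mstar
  (fun A B mA mB => nondesc_indep e Snd dis (exo_measurable_fun (set11 Y))
    mA mB) mq (mech_measurable (s := M) ord0 (j := Y))
  (fun w => esym (coords_extend_coords (Z e w) paS))
  (mech_Y_eq e) (integrable_Y e) (cond_exp_env cm) (cond_exp_env cms).
have mne : measurable [set z | m (coords S z) <> mstar (coords paY z)].
  exact: (measurable_neq_set (measurableT_comp mm (@measurable_coords _ _ _))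
    (measurableT_comp mms (@measurable_coords _ _ _))).
rewrite -[LHS]/(P (Z e @^-1` [set z | m (coords S z) <> mstar (coords paY z)])).
apply/negligibleP; first exact: measurable_funPTI.
exact: H.
Qed.

(** * A first child of Y on which no environment intervenes *)

Section unintervened_child.
Variable j : 'I_d.+1.
Hypothesis jY : j \in ch pa Y.
Hypothesis jdis : [disjoint at_ pa j & ch pa Y]%B.
Hypothesis jI : j \notin intervened M.

(** The indices of the vector N: together with [U Y] and [U j] they determine Y, and then the
    variable [j]. *)
Definition inputs : {set 'I_d.+1} := ((pa j :|: paY) :\ Y)%SET.

Let Yj : Y \in pa j. Proof. by move: jY; rewrite inE. Qed.

Let j_neq_Y : j != Y.
Proof.
by have := parents_acyclic M Y; apply: contraNneq => {2}<-; exact: parent_at.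
Qed.

Let paY_inputs : paY \subset inputs.
Proof.
rewrite /inputs subsetD1 finset.subsetUr /=.
by apply: contraNN (parents_acyclic M Y) => ?; exact: parent_at.
Qed.

Let inputs_nondesc : inputs \subset nondesc.
Proof.
apply/fintype.subsetP => i; rewrite in_setD1 finset.in_setU => /andP[iY /orP[ij|iY']].
  by rewrite mem_nondesc iY (disjoint_ch_notin_at jdis)// parent_at.
exact: (fintype.subsetP pa_nondesc).
Qed.

Let j_inputs : j \notin inputs.
Proof.
apply/negP => /(fintype.subsetP inputs_nondesc).
by rewrite mem_nondesc (parent_at Yj) andbF.
Qed.

Let mech_j e : mech M e j = mech M ord0 j.
Proof.
move: jI; rewrite inE j_neq_Y /= => /asboolPn ne.
by apply: contrapT => ne'; apply: ne; exists e.
Qed.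

(** [f] computes Y and [g] the regressors, with the mechanisms of environment 0; these hold in every
    environment, by [mech_Y] and [mech_j]. *)
Let f (x : #|inputs|.-tuple R * (T Y * T j)) : R :=
  mech M ord0 Y (coords paY (extend x.1)) x.2.1.

(** Correct on [inputs] and Y, which cover the parents of [j]; the other coordinates are 0 and are
    not read by the mechanism of [j]. *)
Let z1 (x : #|inputs|.-tuple R * (T Y * T j)) : d.+1.-tuple R :=
  set_coord (extend x.1) Y (f x).

Let g (x : #|inputs|.-tuple R * (T Y * T j)) : #|(j |: inputs)%SET|.-tuple R :=
  coords (j |: inputs)%SET
    (set_coord (z1 x) j (mech M ord0 j (coords (pa j) (z1 x)) x.2.2)).

Let mf : measurable_fun setT f.
Proof.
apply: (measurableT_comp (f := fun xu => mech M ord0 Y xu.1 xu.2)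
  (g := fun x => (coords paY (extend x.1), x.2.1))); first exact: mech_measurable.
apply: measurable_fun_pair.
  apply: measurableT_comp (@measurable_coords _ _ _) _.
  exact: measurableT_comp (@measurable_extend _ _ _) measurable_fst.
exact: measurableT_comp measurable_fst measurable_snd.
Qed.

Let mz1 : measurable_fun setT z1.
Proof.
apply: measurable_set_coord => //.
exact: measurableT_comp (@measurable_extend _ _ _) measurable_fst.
Qed.

Let mg : measurable_fun setT g.
Proof.
apply: measurableT_comp (@measurable_coords _ _ _) _.
apply: measurable_set_coord => //.
apply: (measurableT_comp (f := fun xu => mech M ord0 j xu.1 xu.2)
  (g := fun x => (coords (pa j) (z1 x), x.2.2))); first exact: mech_measurable.
apply: measurable_fun_pair.
  exact: measurableT_comp (@measurable_coords _ _ _) mz1.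
exact: measurableT_comp measurable_snd measurable_snd.
Qed.

(** The regressors include N, which is what fibrewise conditioning requires. *)
Let p (x : #|(j |: inputs)%SET|.-tuple R) : #|inputs|.-tuple R :=
  coords inputs (extend x).

Let inputsU : inputs \subset (j |: inputs)%SET.
Proof. exact: finset.subsetUr. Qed.

Let pg x : p (g x) = x.1.
Proof.
rewrite /p /g coords_extend_coords// -[RHS]coords_extend; apply: coords_eq => i iS.
rewrite !tnth_set_coord ifN; last by apply: contraNneq j_inputs => <-.
by rewrite ifN//; move: iS; rewrite in_setD1 => /andP[].
Qed.

Let V : {mfun Omega >-> (T Y * T j)%type} := pair_rv (U Y) (U j).

Let N e : {mfun Omega >-> #|inputs|.-tuple R} := coords inputs \o Z e.

Let YE e w : tnth (Z e w) Y = f (N e w, V w).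
Proof. by rewrite /f /= coords_extend_coords// mech_Y_eq. Qed.

Let XE e w : coords (j |: inputs)%SET (Z e w) = g (N e w, V w).
Proof.
have z1E i : i \in pa j -> tnth (z1 (N e w, V w)) i = tnth (Z e w) i.
  move=> ij; rewrite tnth_set_coord; case: eqVneq => [->|iY]; first by rewrite YE.
  by rewrite extend_coords// in_setD1 iY finset.in_setU ij.
apply: coords_eq => i; rewrite finset.in_setU1 tnth_set_coord.
case: eqVneq => [-> _|_ /= iS]; first by rewrite (hZ e) mech_j (coords_eq z1E).
rewrite tnth_set_coord ifN ?extend_coords//.
by move: iS; rewrite in_setD1 => /andP[].
Qed.

Let disYj : [disjoint nondesc & [set Y; j]%SET]%B.
Proof.
apply/pred0P => l; apply/negP => /= /andP[lnd /set2P[lE|lE]]; move: lnd;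
  rewrite mem_nondesc lE ?eqxx//.
by rewrite (parent_at Yj) andbF.
Qed.

Let NV e A B : measurable A -> measurable B ->
  P (N e @^-1` A `&` V @^-1` B) = (P (N e @^-1` A) * P (V @^-1` B))%E.
Proof.
move=> mA mB; apply: (nondesc_indep e inputs_nondesc disYj) => //.
by apply: measurable_fun_pair; apply: exo_measurable_fun; rewrite !inE eqxx ?orbT.
Qed.

(** [regressions_agree] supplies [B], and [meet_le] is applied to the event that the inputs lie in
    [B]. *)
Lemma child_regressions_agree e e' (m m' : #|(j |: inputs)%SET|.-tuple R -> R) :
  is_cond_exp (env_law P Z e) (@coords R _ (j |: inputs)%SET)
    (fun z => tnth z Y) m ->
  is_cond_exp (env_law P Z e') (@coords R _ (j |: inputs)%SET)
    (fun z => tnth z Y) m' ->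
  (meet (env_law P Z e) (env_law P Z e')
     [set z | m (coords (j |: inputs)%SET z) <> m' (coords (j |: inputs)%SET z)]
   <= 0)%E.
Proof.
move=> cm cm'; have [mm _ _] := cm; have [mm' _ _] := cm'.
have mp : measurable_fun setT p.
  exact: measurableT_comp (@measurable_coords _ _ _) (@measurable_extend _ _ _).
have [B [mB B0 B'0]] := regressions_agree
  (X := coords (j |: inputs)%SET \o Z e) (X' := coords (j |: inputs)%SET \o Z e')
  (@NV e) (@NV e') mf mg mp pg (YE e) (YE e')
  (XE e) (XE e') (integrable_Y e) (integrable_Y e') (cond_exp_env cm)
  (cond_exp_env cm').
have mA := measurable_neq_set (measurableT_comp mm (@measurable_coords R d.+1 _))
  (measurableT_comp mm' (@measurable_coords R d.+1 _)).
have mC : measurable (@coords R d.+1 inputs @^-1` B) by exact: measurable_funPTI.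
apply: le_trans (meet_le (env_law P Z e) (env_law P Z e') mA mC) _.
by rewrite [X in (X + _)%E]B0 [X in (_ + X)%E]B'0 adde0.
Qed.

End unintervened_child.

End structural.

(** * The augmented graph and d-separation *)

Lemma at_homo (V V' : finType) (pa : V -> {set V}) (pa' : V' -> {set V'})
    (h : V -> V') :
  acyclic pa -> (forall i j, i \in pa j -> h i \in pa' (h j)) ->
  forall i j, i \in at_ pa j -> h i \in at_ pa' (h j).
Proof.
move=> acy hpa i j; elim/(parent_ind acy): j => j IH.
rewrite at_rec finset.in_setU => /orP[ij|/bigcupP[l lj il]].
  by rewrite parent_at// hpa.
exact: at_parent (IH l lj il) (hpa _ _ lj).
Qed.

Section augmented_graph.
Context (R : realType) (d k : nat) (dU : 'I_d.+1 -> measure_display)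
  (T : forall j, measurableType (dU j)) (M : scm R k T).

Lemma node_up_aug_pa i j :
  (node_up i \in aug_pa M (node_up j)) = (i \in parents M j).
Proof. by rewrite inE !liftK. Qed.

Lemma node_E_aug_pa j :
  (node_E d \in aug_pa M (node_up j)) = (j \in intervened M).
Proof. by rewrite inE liftK unlift_none. Qed.

(** Some [c'] in [Istar] is an element [s] of [S] or an ancestor of it. As [c'] is intervened on, it
    is a collider between E and Y, and [s] opens it. *)
Lemma intervened_desc_connected (S : {set 'I_d.+1}) :
  Istar M \subset intervened M -> node_Y d \notin S ->
  node_Y d \in (\bigcup_(j in S) at_ (parents M) j)%SET ->
  ~ d_separated (aug_pa M) [set node_E d]%SET [set node_up (node_Y d)]%SET
      (@node_up d @: S)%SET.
Proof.
move=> II YS /bigcupP[s sS /at_child[c cY cs]].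
have [c' [c'Y dis c'c]] := first_child (parents_acyclic M) cY.
have c's : (c' == s) || (c' \in at_ (parents M) s).
  case/orP: c'c => [/eqP->//|c'c]; apply/orP; right.
  by case/orP: cs => [/eqP<-//|]; exact: at_trans.
have c'I : c' \in intervened M by apply: (fintype.subsetP II); rewrite inE c'Y.
have Yc' : node_Y d \in parents M c' by move: c'Y; rewrite inE.
move=> /(_ (node_E d) [:: node_up c'; node_up (node_Y d)]).
rewrite !inE !eqxx => /(_ isT isT).
have -> : path (fun i j => (i \in aug_pa M j) || (j \in aug_pa M i))
    (node_E d) [:: node_up c'; node_up (node_Y d)].
  by rewrite /= node_E_aug_pa c'I !node_up_aug_pa Yc' orbT.
have -> : uniq [:: node_E d; node_up c'; node_up (node_Y d)].
  rewrite /= !inE !negb_or !neq_lift /= andbT (inj_eq (@lift_inj _ _)).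
  by apply: contraTneq Yc' => ->; apply: contraNN (parents_acyclic M (node_Y d));
    exact: parent_at.
move=> /(_ isT isT); rewrite /= node_E_aug_pa node_up_aug_pa c'I Yc' /= andbT.
case/exists_inP; exists (node_up s); first exact: imset_f.
case/orP: c's => [/eqP->|c's]; first by rewrite eqxx.
apply/orP; right; apply: at_homo c's; first exact: parents_acyclic.
by move=> i j; rewrite node_up_aug_pa.
Qed.

End augmented_graph.

(** * Sufficiency and necessity combined *)

Theorem proposition3p1 (R : realType) (d k : nat)
    (dU : 'I_d.+1 -> measure_display) (T : forall j, measurableType (dU j))
    (M : scm R k T)
    (dO : measure_display) (Omega : measurableType dO) (P : probability Omega R)
    (U : forall j, {mfun Omega >-> T j}) (UE : Omega -> 'I_k.+1)
    (hU : exogenous P U UE)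
    (Z : 'I_k.+1 -> {mfun Omega >-> d.+1.-tuple R})
    (hZ : forall e, env_solution M U e (Z e))
    (Zt : {mfun Omega >-> d.+2.-tuple R})
    (hZt : aug_solution M U UE Zt)
    (hY2 : forall e,
      ('E_P[fun w => (`|tnth (Z e w) (node_Y d)| ^+ 2)%R] < +oo)%E)
    (m : 'I_k.+1 -> forall S : {set 'I_d.+1}, #|S|.-tuple R -> R)
    (hm : forall e (S : {set 'I_d.+1}), node_Y d \notin S ->
      is_cond_exp (env_law P Z e) (@coords R _ S)
        (fun z => tnth z (node_Y d)) (m e S))
    (mstar : #|parents M (node_Y d)|.-tuple R -> R)
    (hmstar : forall e,
      is_cond_exp (env_law P Z e) (@coords R _ (parents M (node_Y d)))
        (fun z => tnth z (node_Y d)) mstar) :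
  ((forall S : {set 'I_d.+1}, node_Y d \notin S ->
      node_Y d \in (\bigcup_(j in S) at_ (parents M) j)%SET ->
      ~ cond_indep (aug_law P Zt)
          (@coords R _ [set node_E d]%SET)
          (@coords R _ [set node_up (node_Y d)]%SET)
          (@coords R _ (@node_up d @: S)) ->
      envs_differ (env_law P Z) m S) ->
    faithful M (aug_law P Zt) ->
    Istar M \subset intervened M ->
    identifiable (env_law P Z) m mstar) /\
  ((forall S : {set 'I_d.+1}, node_Y d \notin S ->
      ~~ [disjoint ch (parents M) (node_Y d) & S]%B ->
      mbar_differs (env_law P Z) m S mstar) ->
    identifiable (env_law P Z) m mstar ->
    Istar M \subset intervened M).
Proof.
split.
- move=> ha faith II S YS mdiff.
  have [YdS|YdS] := boolP (node_Y d \in (\bigcup_(j in S) at_ (parents M) j)%SET).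
    apply: ha => // ci; apply: (intervened_desc_connected II YS YdS).
    apply: faith ci.
    + by rewrite disjoints1 inE; exact: neq_lift.
    + rewrite disjoints1; apply/imsetP => -[j _ /eqP]; apply/negP; exact: neq_lift.
    + rewrite disjoints1; apply/imsetP => -[j jS /lift_inj Yj].
      by move: YS; rewrite Yj jS.
  (* Without a descendant of Y in [S], the pooled regression is [mstar] almost everywhere, which
     contradicts [mdiff]. *)
  have Snd : (S :|: parents M (node_Y d))%SET \subset nondesc M.
    apply/fintype.subsetP => j; rewrite finset.in_setU => /orP[jS|]; last first.
      exact: (fintype.subsetP (pa_nondesc M)).
    rewrite mem_nondesc; apply/andP; split; first by apply: contraNneq YS => <-.
    by apply: contraNN YdS => Yj; apply/bigcupP; exists j.
  have YU : node_Y d \notin (S :|: parents M (node_Y d))%SET.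
    by apply/negP => /(fintype.subsetP Snd); rewrite mem_nondesc eqxx.
  have mr : measurable_fun setT (coords (parents M (node_Y d)) \o
      @extend R _ (S :|: parents M (node_Y d))%SET).
    exact: measurableT_comp (@measurable_coords _ _ _) (@measurable_extend _ _ _).
  have [mms _ _] := hmstar ord0.
  have paU : parents M (node_Y d) \subset (S :|: parents M (node_Y d))%SET.
    exact: finset.subsetUr.
  move: mdiff; rewrite /mbar_differs (mbar_invariant (m := m) mr mms) ?ltxx//.
  + by move=> e; have [] := hm e _ YU.
  + by move=> z; rewrite /= coords_extend_coords.
  + move=> e; exact: (regression_nondesc hU hZ hY2 paU Snd (hm e _ YU) (hmstar e)).
- move=> hdiff hid; apply/fintype.subsetP => j; rewrite inE => /andP[jY jdis].
  apply: contraT => jI.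
  (* [S] contains the child [j], so [hdiff] and [hid] give two environments whose regressions on [S]
     differ, although [j] is not intervened on. *)
  pose S := (j |: inputs M j)%SET.
  have YS : node_Y d \notin S.
    rewrite !inE eqxx /= orbF; apply: contraNneq (parents_acyclic M (node_Y d)).
    by move=> Yj; apply: parent_at; move: jY; rewrite inE -Yj.
  have jS : ~~ [disjoint ch (parents M) (node_Y d) & S]%B.
    by apply/pred0Pn; exists j; rewrite /= jY finset.setU11.
  have [e [e']] := hid S YS (hdiff S YS jS).
  rewrite ltNge (child_regressions_agree hU hZ hY2 jY jdis jI (hm e _ YS))//.
  exact: hm.
Qed.
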